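(* Let $\lambda\in\mathbb{C}$ with $\mathrm{Re}\,\lambda\ge\frac12$ and let $u\in C^\infty[0,1]$ be a nontrivial (complex-valued) solution of $$-(1-\rho^2)u''(\rho)-2\frac{1-\rho^2}{\rho}u'(\rho)+2\lambda\rho u'(\rho)+\frac{V(\rho)}{\rho^2}u(\rho)+\lambda(\lambda+1)u(\rho)=0$$ on $(0,1)$, where $V(\rho)=\frac{2(1-6\rho^2+\rho^4)}{(1+\rho^2)^2}$. Then $\lambda=1$ and there exists a (nonzero) constant $c\in\mathbb{C}$ such that $u(\rho)=\frac{c\rho}{1+\rho^2}$.
   Context: $'$ denotes the derivative with respect to $\rho$. The space $C^\infty[0,1]$ consists of complex-valued functions smooth up to both endpoints. *)

(* Defs.v *)
From Stdlib Require Import Reals Lra.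
From Coquelicot Require Import Coquelicot.

Open Scope R_scope.

(** [u] belongs to C^oo[a,b]: [u] is infinitely differentiable on (a,b), and
    [u] and all its derivatives extend continuously to [a,b].  [D n] is the
    continuous extension of the n-th derivative.  The values of [u] outside
    [a,b] are irrelevant. *)
Definition smooth_on_closed (a b : R) (u : R -> C) : Prop :=
  exists D : nat -> R -> C,
    (forall x, a <= x <= b -> D 0%nat x = u x) /\
    (forall n x, a < x < b ->
       is_derive (K := R_AbsRing) (V := C_R_NormedModule) (D n) x (D (S n) x)) /\
    (forall n x, a <= x <= b ->
       filterlim (D n) (within (fun y => a <= y <= b) (locally x))
         (locally (D n x))).

Definition V (rho : R) : R :=
  2 * (1 - 6 * rho ^ 2 + rho ^ 4) / (1 + rho ^ 2) ^ 2.

Definition mode_equation (lambda : C) (rho : R) (u0 u1 u2 : C) : Prop :=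
  (- (RtoC (1 - rho ^ 2) * u2)
   - RtoC (2 * ((1 - rho ^ 2) / rho)) * u1
   + 2 * lambda * RtoC rho * u1
   + RtoC (V rho / rho ^ 2) * u0
   + lambda * (lambda + 1) * u0 = 0)%C.

(** The derivatives [u1], [u2] are uniquely determined on (0,1). *)
Definition solves_mode_equation (lambda : C) (u : R -> C) : Prop :=
  exists u1 u2 : R -> C,
    forall rho, 0 < rho < 1 ->
      is_derive (K := R_AbsRing) (V := C_R_NormedModule) u rho (u1 rho) /\
      is_derive (K := R_AbsRing) (V := C_R_NormedModule) u1 rho (u2 rho) /\
      mode_equation lambda rho (u rho) (u1 rho) (u2 rho).

(* Main.v *)
Require Import Defs.
From Stdlib Require Import Reals Lra.
From Coquelicot Require Import Coquelicot.

Open Scope R_scope.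

(** Put [kappa = lambda - 1], [v = rho u] and [W = 2 (1-rho^2) / (rho (1+rho^2))],
    the superpotential of the solution [rho^2 / (1+rho^2)] at [lambda = 1].  The
    Darboux transform [w = (1-rho^2) v' - (kappa rho + W) v] satisfies
    [(1-rho^2) w' = (kappa rho - W) w + kappa^2 v], hence an equation of the same
    type in which [V/rho^2] is replaced by the positive potential
    [U = 2 (3-rho^2) / (rho^2 (1+rho^2))], for which [rho^2 U] is decreasing.
    With [g = kappa w + rho w'] and [e = (|g|^2 + |w'|^2 + U |w|^2) / 2], the local
    energy [H = rho e - Re (w' conj g)] satisfies
    [H' = - (2 Re lambda - 1) e - 8 |w|^2 / (1+rho^2)^2 <= 0], while [H = 0] at
    [rho = 0] and [H >= 0] at [rho = 1].  So [H] and [w] vanish identically,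
    whence [kappa^2 v = 0], [kappa = 0], and [v] is proportional to
    [rho^2 / (1+rho^2)]. *)

(** * Passage to the endpoints of an interval by continuity *)

Lemma continuity_nonneg_closure (f : R -> R) (a b : R) :
  continuity f -> a < b -> (forall s, a < s < b -> 0 <= f s) ->
  forall s, a <= s <= b -> 0 <= f s.
Proof.
  intros Hc Hab Hf s Hs.
  destruct (Rle_lt_dec 0 (f s)) as [H | H]; [exact H | exfalso].
  destruct (Hc s (- f s)) as [d [Hd Hlim]]; [lra |].
  assert (Hnear : forall y, a < y < b -> Rabs (y - s) < d -> s <> y -> False).
  { intros y Hy Hys Hne. specialize (Hf y Hy).
    assert (Rabs (f y - f s) < - f s) as Habs.
    { apply Hlim; split; [split; [exact I | exact Hne] | exact Hys]. }
    apply Rabs_def2 in Habs. lra. }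
  (* A point near [s] on the side of the farther endpoint lies inside [(a, b)], even when [s] is
     itself an endpoint. *)
  destruct (Rle_lt_dec s ((a + b) / 2)) as [Hm | Hm].
  - apply (Hnear (s + Rmin (d / 2) ((b - a) / 4)));
      pose proof (Rmin_l (d / 2) ((b - a) / 4));
      pose proof (Rmin_r (d / 2) ((b - a) / 4));
      assert (0 < Rmin (d / 2) ((b - a) / 4)) by (apply Rmin_glb_lt; lra).
    + lra.
    + rewrite Rabs_pos_eq; lra.
    + lra.
  - apply (Hnear (s - Rmin (d / 2) ((b - a) / 4)));
      pose proof (Rmin_l (d / 2) ((b - a) / 4));
      pose proof (Rmin_r (d / 2) ((b - a) / 4));
      assert (0 < Rmin (d / 2) ((b - a) / 4)) by (apply Rmin_glb_lt; lra).
    + lra.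
    + rewrite Rabs_left; lra.
    + lra.
Qed.

Lemma continuity_zero_closure (f : R -> R) (a b : R) :
  continuity f -> a < b -> (forall s, a < s < b -> f s = 0) ->
  forall s, a <= s <= b -> f s = 0.
Proof.
  intros Hc Hab Hf s Hs. apply Rle_antisym.
  - apply Ropp_le_cancel. rewrite Ropp_0.
    apply (continuity_nonneg_closure (fun y => - f y) a b); try assumption.
    + apply (continuity_opp f Hc).
    + intros y Hy. rewrite (Hf y Hy). lra.
  - apply (continuity_nonneg_closure f a b); try assumption.
    intros y Hy. rewrite (Hf y Hy). lra.
Qed.

(** * Reduction to real functions continuous on the whole line *)

Definition clamp (x : R) : R := Rmax 0 (Rmin x 1).

Lemma clamp_range (x : R) : 0 <= clamp x <= 1.
Proof. unfold clamp, Rmax, Rmin; repeat destruct Rle_dec; lra. Qed.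

Lemma clamp_id (x : R) : 0 <= x <= 1 -> clamp x = x.
Proof. unfold clamp, Rmax, Rmin; repeat destruct Rle_dec; lra. Qed.

Lemma clamp_lipschitz (x y : R) : Rabs (clamp y - clamp x) <= Rabs (y - x).
Proof.
  unfold clamp, Rmax, Rmin, Rabs;
    repeat destruct Rle_dec; repeat destruct Rcase_abs; lra.
Qed.

Lemma clamp_within (x : R) :
  filterlim clamp (locally x)
    (within (fun y => 0 <= y <= 1) (locally (clamp x))).
Proof.
  intros P [d Hd]. exists d. intros y Hy.
  apply Hd.
  - apply Rle_lt_trans with (2 := Hy). apply clamp_lipschitz.
  - apply clamp_range.
Qed.

Lemma locally_Ioo (a b x : R) : a < x < b -> locally x (fun y => a < y < b).
Proof. intros Hx. apply (locally_interval _ x a b); simpl; tauto. Qed.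

Lemma is_derive_fst (f : R -> C) (x : R) (l : C) :
  is_derive (K := R_AbsRing) (V := C_R_NormedModule) f x l ->
  is_derive (fun y => fst (f y)) x (fst l).
Proof.
  intros H.
  exact (filterdiff_comp' f (fun t : C_R_NormedModule => fst t) x _ _ H
           (filterdiff_linear _ is_linear_fst)).
Qed.

Lemma is_derive_snd (f : R -> C) (x : R) (l : C) :
  is_derive (K := R_AbsRing) (V := C_R_NormedModule) f x l ->
  is_derive (fun y => snd (f y)) x (snd l).
Proof.
  intros H.
  exact (filterdiff_comp' f (fun t : C_R_NormedModule => snd t) x _ _ H
           (filterdiff_linear _ is_linear_snd)).
Qed.

Lemma is_derive_clamp (f : R -> R) (x l : R) :
  0 < x < 1 -> is_derive f x l -> is_derive (fun y => f (clamp y)) x l.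
Proof.
  intros Hx. apply is_derive_ext_loc.
  apply (filter_imp _ _ (fun y (Hy : 0 < y < 1) => f_equal f (eq_sym
    (clamp_id y (conj (Rlt_le _ _ (proj1 Hy)) (Rlt_le _ _ (proj2 Hy))))))).
  apply locally_Ioo, Hx.
Qed.

Definition smooth_unit (a : nat -> R -> R) : Prop :=
  (forall n, continuity (a n)) /\
  (forall n x, 0 < x < 1 -> is_derive (a n) x (a (S n) x)).

(* Composing the derivatives with [clamp] turns one-sided continuity on [0,1]
   into continuity on the whole line. *)
Lemma smooth_on_closed_parts (u : R -> C) :
  smooth_on_closed 0 1 u ->
  exists a b : nat -> R -> R, smooth_unit a /\ smooth_unit b /\
    forall x, 0 <= x <= 1 -> u x = (a 0%nat x, b 0%nat x).
Proof.
  intros [D [Hu [Hd Hc]]].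
  assert (Hcc : forall n x,
    filterlim (fun y => D n (clamp y)) (locally x) (locally (D n (clamp x)))).
  { intros n x. apply filterlim_comp with (1 := clamp_within x).
    apply Hc, clamp_range. }
  exists (fun n x => fst (D n (clamp x))), (fun n x => snd (D n (clamp x))).
  split; [split | split; [split |]].
  - intros n x. apply continuity_pt_filterlim.
    eapply filterlim_comp; [apply Hcc |]. destruct (D n (clamp x)).
    apply (continuous_fst (U := R_UniformSpace) (V := R_UniformSpace)).
  - intros n x Hx. rewrite clamp_id by lra.
    apply (is_derive_clamp (fun y => fst (D n y)) x _ Hx).
    apply is_derive_fst, Hd, Hx.
  - intros n x. apply continuity_pt_filterlim.
    eapply filterlim_comp; [apply Hcc |]. destruct (D n (clamp x)).
    apply (continuous_snd (U := R_UniformSpace) (V := R_UniformSpace)).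
  - intros n x Hx. rewrite clamp_id by lra.
    apply (is_derive_clamp (fun y => snd (D n y)) x _ Hx).
    apply is_derive_snd, Hd, Hx.
  - intros x Hx. rewrite clamp_id by lra. rewrite Hu by lra.
    apply surjective_pairing.
Qed.

(** * Real and imaginary parts of the mode equation *)

(** Derivatives are local and [(0,1)] is open. This identifies [u1], [u2] with the derivatives given
    by smoothness, and later lets identities such as [w = 0] be differentiated. *)
Lemma is_derive_det_Ioo (f g : R -> R) (x lf lg : R) :
  0 < x < 1 -> (forall y, 0 < y < 1 -> f y = g y) ->
  is_derive f x lf -> is_derive g x lg -> lf = lg.
Proof.
  intros Hx Hfg Hf Hg.
  rewrite <- (is_derive_unique _ _ _ Hf). apply is_derive_unique.
  apply (is_derive_ext_loc g); [| exact Hg].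
  apply filter_imp with (2 := locally_Ioo 0 1 x Hx).
  intros y Hy. symmetry. apply Hfg, Hy.
Qed.

(* Real part of the mode equation for [u = a + i b] and [lambda = k + 1 + i q].
   The imaginary part is the same equation with [(a, b, q)] replaced by
   [(b, a, - q)]. *)
Definition mode_real (k q : R) (a b : nat -> R -> R) : Prop :=
  forall x, 0 < x < 1 ->
    - ((1 - x ^ 2) * a 2%nat x) - 2 * ((1 - x ^ 2) / x) * a 1%nat x
    + 2 * x * ((k + 1) * a 1%nat x - q * b 1%nat x) + V x / x ^ 2 * a 0%nat x
    + (((k + 1) * (k + 2) - q ^ 2) * a 0%nat x - q * (2 * k + 3) * b 0%nat x)
    = 0.

Lemma mode_equation_parts (lambda : C) (u : R -> C) (a b : nat -> R -> R) :
  smooth_unit a -> smooth_unit b ->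
  (forall x, 0 <= x <= 1 -> u x = (a 0%nat x, b 0%nat x)) ->
  solves_mode_equation lambda u ->
  mode_real (fst lambda - 1) (snd lambda) a b /\
  mode_real (fst lambda - 1) (- snd lambda) b a.
Proof.
  intros [_ Ha] [_ Hb] Hu [u1 [u2 Hs]].
  assert (H1 : forall x, 0 < x < 1 -> u1 x = (a 1%nat x, b 1%nat x)).
  { intros x Hx. destruct (Hs x Hx) as [Hd _].
    rewrite (surjective_pairing (u1 x)). f_equal.
    - apply (is_derive_det_Ioo (fun y => fst (u y)) (a 0%nat) x); auto.
      + intros y Hy. rewrite Hu by lra. reflexivity.
      + apply is_derive_fst, Hd.
    - apply (is_derive_det_Ioo (fun y => snd (u y)) (b 0%nat) x); auto.
      + intros y Hy. rewrite Hu by lra. reflexivity.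
      + apply is_derive_snd, Hd. }
  assert (H2 : forall x, 0 < x < 1 -> u2 x = (a 2%nat x, b 2%nat x)).
  { intros x Hx. destruct (Hs x Hx) as [_ [Hd _]].
    rewrite (surjective_pairing (u2 x)). f_equal.
    - apply (is_derive_det_Ioo (fun y => fst (u1 y)) (a 1%nat) x); auto.
      + intros y Hy. rewrite H1 by lra. reflexivity.
      + apply is_derive_fst, Hd.
    - apply (is_derive_det_Ioo (fun y => snd (u1 y)) (b 1%nat) x); auto.
      + intros y Hy. rewrite H1 by lra. reflexivity.
      + apply is_derive_snd, Hd. }
  split; intros x Hx; destruct (Hs x Hx) as [_ [_ He]]; unfold mode_equation in He;
    rewrite (Hu x), (H1 x), (H2 x) in He by lra; destruct lambda as [p q];
    unfold Cplus, Cminus, Copp, Cmult, RtoC in He; simpl fst in *; simpl snd in *;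
    injection He; intros Hi Hr.
  - rewrite <- Hr. field. lra.
  - rewrite <- Hi. field. lra.
Qed.

(** * The partner equation and its local energy *)

Definition partner_potential (t : R) : R := 2 * (3 - t ^ 2) / (t ^ 2 * (1 + t ^ 2)).

(* Real part of the mode equation with [V/rho^2] replaced by the partner
   potential, in the form taken by [rho * u]. *)
Definition partner_real (k q : R) (x1 x2 y1 y2 z1 : R -> R) : Prop :=
  forall t, 0 < t < 1 ->
    - ((1 - t ^ 2) * z1 t) + 2 * t * ((k + 1) * y1 t - q * y2 t)
    + ((k * (k + 1) - q ^ 2) * x1 t - q * (2 * k + 1) * x2 t)
    + partner_potential t * x1 t = 0.

Lemma nonincreasing_Ioo (h dh : R -> R) (s t : R) :
  (forall x, 0 < x < 1 -> is_derive h x (dh x)) ->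
  (forall x, 0 < x < 1 -> dh x <= 0) ->
  0 < s < t -> t < 1 -> h t <= h s.
Proof.
  intros Hd Hn Hs Ht.
  destruct (MVT_gen h s t dh) as [c [Hc He]].
  - intros x. rewrite Rmin_left, Rmax_right by lra. intros Hx. apply Hd. lra.
  - intros x. rewrite Rmin_left, Rmax_right by lra. intros Hx.
    apply continuity_pt_filterlim.
    apply (ex_derive_continuous (K := R_AbsRing) (V := R_NormedModule) h).
    exists (dh x). apply Hd. lra.
  - rewrite Rmin_left, Rmax_right in Hc by lra.
    specialize (Hn c ltac:(lra)). nra.
Qed.

(* The eta-expanded form is the one that [auto_derive] leaves in its goals. *)
Lemma Derive_eta (f : R -> R) (x l : R) :
  is_derive f x l -> Derive (fun y : R => f y) x = l.
Proof. apply is_derive_unique. Qed.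

Ltac solve_continuity :=
  repeat first
    [ assumption
    | apply derivable_continuous, derivable_id
    | match goal with
      | |- continuity (fun _ => ?c) => apply continuity_const; intros ? ?; reflexivity
      | |- continuity (fun x => @?f x + @?g x) => apply (continuity_plus f g)
      | |- continuity (fun x => @?f x - @?g x) => apply (continuity_minus f g)
      | |- continuity (fun x => @?f x * @?g x) => apply (continuity_mult f g)
      | |- continuity (fun x => - @?f x) => apply (continuity_opp f)
      | |- continuity (fun x => @?f x ^ 2) =>
          apply (continuity_comp f (fun x => x ^ 2));
          [| apply derivable_continuous, derivable_pow]
      | |- continuity (fun x => @?f x / @?g x) =>
          apply (continuity_div f g); [ | | intros ?; nra ]
      end ].

(** By the mean value theorem [x t = y d * t], so the maximum of [y ^ 2] on [[0,1]] serves as [M].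
    The quadratic decay compensates the [1/t^2] singularity of the partner potential. *)
Lemma vanishing_sqr_bound (x y : R -> R) :
  continuity x -> continuity y -> x 0 = 0 ->
  (forall t, 0 < t < 1 -> is_derive x t (y t)) ->
  exists M, forall t, 0 < t < 1 -> x t ^ 2 <= M * t ^ 2.
Proof.
  intros Cx Cy X0 Dx.
  destruct (continuity_ab_maj (fun t => y t ^ 2) 0 1) as [c [Hmax _]]; [lra | |].
  { intros t _. revert t. change (continuity (fun t => y t ^ 2)). solve_continuity. }
  exists (y c ^ 2). intros t Ht.
  destruct (MVT_gen x 0 t y) as [d [Hd He]].
  - intros s. rewrite Rmin_left, Rmax_right by lra. intros Hs. apply Dx. lra.
  - intros s _. apply Cx.
  - rewrite Rmin_left, Rmax_right in Hd by lra.
    replace (x t) with (y d * t) by lra.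
    specialize (Hmax d ltac:(lra)). simpl in Hmax. nra.
Qed.

(* Up to a power of [1-T], [H] below is the energy in a backward light cone of
   the wave [(1-T)^(1-lambda) w(r/(1-T))]. *)
Lemma partner_trivial (k q : R) (x1 x2 y1 y2 z1 z2 : R -> R) :
  - 1 / 2 <= k ->
  continuity x1 -> continuity x2 -> continuity y1 -> continuity y2 ->
  x1 0 = 0 -> x2 0 = 0 ->
  (forall t, 0 < t < 1 -> is_derive x1 t (y1 t)) ->
  (forall t, 0 < t < 1 -> is_derive x2 t (y2 t)) ->
  (forall t, 0 < t < 1 -> is_derive y1 t (z1 t)) ->
  (forall t, 0 < t < 1 -> is_derive y2 t (z2 t)) ->
  partner_real k q x1 x2 y1 y2 z1 ->
  partner_real k (- q) x2 x1 y2 y1 z2 ->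
  forall t, 0 < t < 1 -> x1 t = 0 /\ x2 t = 0.
Proof.
  intros Hk Cx1 Cx2 Cy1 Cy2 X1 X2 Dx1 Dx2 Dy1 Dy2 E1 E2.
  set (g1 := fun t => k * x1 t - q * x2 t + t * y1 t).
  set (g2 := fun t => k * x2 t + q * x1 t + t * y2 t).
  set (n := fun t => g1 t ^ 2 + g2 t ^ 2 + (y1 t ^ 2 + y2 t ^ 2)).
  (* [m] is the part of [H] that is continuous on the whole line; the potential term, singular at 0,
     is estimated separately. *)
  set (m := fun t => t / 2 * n t - (y1 t * g1 t + y2 t * g2 t)).
  set (U := partner_potential).
  set (H := fun t => m t + t / 2 * (U t * (x1 t ^ 2 + x2 t ^ 2))).
  (* The coefficient [- 8 / (1 + t ^ 2) ^ 2] is [(t^2 U)' / (2 t)]. *)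
  set (dH := fun t => - (2 * k + 1) / 2 * (n t + U t * (x1 t ^ 2 + x2 t ^ 2))
                      - 8 / (1 + t ^ 2) ^ 2 * (x1 t ^ 2 + x2 t ^ 2)).
  assert (Ug : forall t, 0 < t < 1 -> 0 < U t).
  { intros t Ht. unfold U, partner_potential.
    apply Rdiv_lt_0_compat; [nra |]. apply Rmult_lt_0_compat; nra. }
  assert (HD : forall t, 0 < t < 1 -> is_derive H t (dH t)).
  { intros t Ht. specialize (Dx1 t Ht). specialize (Dx2 t Ht).
    specialize (Dy1 t Ht). specialize (Dy2 t Ht).
    assert (Z1 : z1 t = (2 * t * ((k + 1) * y1 t - q * y2 t)
      + ((k * (k + 1) - q ^ 2) * x1 t - q * (2 * k + 1) * x2 t)
      + U t * x1 t) / (1 - t ^ 2)).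
    { specialize (E1 t Ht). fold U in E1.
      apply Rmult_eq_reg_l with (1 - t ^ 2); [| nra]. field_simplify; [| nra]. lra. }
    assert (Z2 : z2 t = (2 * t * ((k + 1) * y2 t + q * y1 t)
      + ((k * (k + 1) - q ^ 2) * x2 t + q * (2 * k + 1) * x1 t)
      + U t * x2 t) / (1 - t ^ 2)).
    { specialize (E2 t Ht). fold U in E2.
      apply Rmult_eq_reg_l with (1 - t ^ 2); [| nra]. field_simplify; [| nra]. lra. }
    unfold H, dH, m, n, g1, g2, U, partner_potential.
    auto_derive.
    - repeat split; try (eexists; eassumption); try nra.
    - rewrite (Derive_eta x1 _ _ Dx1), (Derive_eta x2 _ _ Dx2),
        (Derive_eta y1 _ _ Dy1), (Derive_eta y2 _ _ Dy2), Z1, Z2.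
      unfold U, partner_potential.
      field. repeat split; nra. }
  assert (Hdec : forall t, 0 < t < 1 -> dH t <= 0).
  { intros t Ht. unfold dH. specialize (Ug t Ht).
    assert (0 <= n t) by (unfold n; nra).
    assert (0 <= U t * (x1 t ^ 2 + x2 t ^ 2)) by (apply Rmult_le_pos; nra).
    assert (0 <= 8 / (1 + t ^ 2) ^ 2 * (x1 t ^ 2 + x2 t ^ 2)).
    { apply Rmult_le_pos; [| nra]. apply Rlt_le, Rdiv_lt_0_compat; [lra |].
      apply pow_lt. nra. }
    nra. }
  assert (Cm : continuity m).
  { unfold m, n, g1, g2, Rdiv. solve_continuity. }
  destruct (vanishing_sqr_bound x1 y1 Cx1 Cy1 X1 Dx1) as [M1 HM1].
  destruct (vanishing_sqr_bound x2 y2 Cx2 Cy2 X2 Dx2) as [M2 HM2].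
  (* [H t <= H s] for [s < t]; now [s] tends to 0. There [m] vanishes, and the potential term is at
     most [3 (M1 + M2) s] because [s^2 U / 2 = (3 - s^2) / (1 + s^2) <= 3]. *)
  assert (Hle : forall t, 0 < t < 1 -> H t <= 0).
  { intros t Ht.
    assert (Hb : forall s, 0 < s < t -> 0 <= m s + 3 * (M1 + M2) * s - H t).
    { intros s Hs.
      pose proof (nonincreasing_Ioo H dH s t HD Hdec Hs (proj2 Ht)) as Hst.
      assert (s / 2 * (U s * (x1 s ^ 2 + x2 s ^ 2)) <= 3 * (M1 + M2) * s).
      { specialize (HM1 s ltac:(lra)). specialize (HM2 s ltac:(lra)).
        apply Rle_trans with (s / 2 * (U s * ((M1 + M2) * s ^ 2))).
        - apply Rmult_le_compat_l; [lra |].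
          apply Rmult_le_compat_l; [apply Rlt_le, Ug; lra | lra].
        - replace (s / 2 * (U s * ((M1 + M2) * s ^ 2)))
            with ((M1 + M2) * s * ((3 - s ^ 2) / (1 + s ^ 2)))
            by (unfold U, partner_potential; field; nra).
          assert ((3 - s ^ 2) / (1 + s ^ 2) <= 3).
          { apply Rle_div_l; nra. }
          assert (0 <= M1 + M2).
          { assert (0 < s ^ 2) by nra. nra. }
          assert (0 <= (M1 + M2) * s) by nra. nra. }
      unfold H in Hst at 2. lra. }
    assert (C0 : continuity (fun s => m s + 3 * (M1 + M2) * s - H t)).
    { solve_continuity. }
    pose proof (continuity_nonneg_closure _ 0 t C0 (proj1 Ht) Hb 0 ltac:(lra)) as H0.
    simpl in H0. unfold m, g1, g2 in H0. rewrite X1, X2 in H0. lra. }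
  (* [H t >= H s >= m s] for [s > t]; as [s] tends to 1, [m] tends to [|g - w'|^2 / 2 >= 0]. *)
  assert (Hge : forall t, 0 < t < 1 -> 0 <= H t).
  { intros t Ht.
    assert (Hb : forall s, t < s < 1 -> 0 <= H t - m s).
    { intros s Hs.
      pose proof (nonincreasing_Ioo H dH t s HD Hdec ltac:(lra) (proj2 Hs)) as Hst.
      specialize (Ug s ltac:(lra)).
      assert (0 <= s / 2 * (U s * (x1 s ^ 2 + x2 s ^ 2))).
      { apply Rmult_le_pos; [lra |]. apply Rmult_le_pos; nra. }
      unfold H in Hst at 1. lra. }
    assert (C1 : continuity (fun s => H t - m s)) by solve_continuity.
    pose proof (continuity_nonneg_closure _ t 1 C1 (proj2 Ht) Hb 1 ltac:(lra)) as H1.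
    simpl in H1.
    assert (0 <= m 1).
    { unfold m, n.
      replace (1 / 2 * (g1 1 ^ 2 + g2 1 ^ 2 + (y1 1 ^ 2 + y2 1 ^ 2))
               - (y1 1 * g1 1 + y2 1 * g2 1))
        with (((g1 1 - y1 1) ^ 2 + (g2 1 - y2 1) ^ 2) / 2) by field.
      pose proof (pow2_ge_0 (g1 1 - y1 1)). pose proof (pow2_ge_0 (g2 1 - y2 1)).
      lra. }
    lra. }
  intros t Ht.
  (* Now [H] is identically 0. Both terms of [dH] are nonpositive, so each vanishes, and the second
     has a strictly negative coefficient on [|w|^2]. *)
  assert (Hz : dH t = 0).
  { apply (is_derive_det_Ioo H (fun _ => 0) t); auto.
    - intros s Hs. apply Rle_antisym; auto.
    - apply (is_derive_const (K := R_AbsRing) (V := R_NormedModule)). }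
  unfold dH in Hz. specialize (Ug t Ht).
  assert (0 <= n t) by (unfold n; nra).
  assert (0 <= U t * (x1 t ^ 2 + x2 t ^ 2)) by (apply Rmult_le_pos; nra).
  assert (0 < 8 / (1 + t ^ 2) ^ 2).
  { apply Rdiv_lt_0_compat; [lra |]. apply pow_lt. nra. }
  assert (x1 t ^ 2 + x2 t ^ 2 = 0).
  { apply Rle_antisym; [| nra].
    assert (8 / (1 + t ^ 2) ^ 2 * (x1 t ^ 2 + x2 t ^ 2) <= 0) by nra. nra. }
  split; nra.
Qed.

(** * The Darboux transform and its factorisation *)

(* Real part of [(1-x^2) v' - (kappa x + W) v] for [v = x u], where
   [W = 2 (1-x^2) / (x (1+x^2))] is the superpotential of [x^2 / (1+x^2)]. *)
Definition darboux (k q : R) (a b : nat -> R -> R) (x : R) : R :=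
  x * (1 - x ^ 2) * a 1%nat x
  - ((1 - x ^ 2) ^ 2 / (1 + x ^ 2) + k * x ^ 2) * a 0%nat x
  + q * x ^ 2 * b 0%nat x.

Definition darboux' (k q : R) (a b : nat -> R -> R) (x : R) : R :=
  (1 - 3 * x ^ 2) * a 1%nat x + x * (1 - x ^ 2) * a 2%nat x
  - ((1 - x ^ 2) ^ 2 / (1 + x ^ 2) + k * x ^ 2) * a 1%nat x
  - (2 * k * x - 4 * x * (1 - x ^ 2) / (1 + x ^ 2)
     - 2 * x * (1 - x ^ 2) ^ 2 / (1 + x ^ 2) ^ 2) * a 0%nat x
  + 2 * q * x * b 0%nat x + q * x ^ 2 * b 1%nat x.

Lemma darboux_continuity (k q : R) (a b : nat -> R -> R) :
  smooth_unit a -> smooth_unit b -> continuity (darboux k q a b).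
Proof.
  intros [Ca _] [Cb _].
  pose proof (Ca 0%nat). pose proof (Ca 1%nat). pose proof (Cb 0%nat).
  match goal with |- continuity ?f => let g := eval cbv delta [darboux] beta in f in
    change (continuity g) end. solve_continuity.
Qed.

Lemma darboux'_continuity (k q : R) (a b : nat -> R -> R) :
  smooth_unit a -> smooth_unit b -> continuity (darboux' k q a b).
Proof.
  intros [Ca _] [Cb _].
  pose proof (Ca 0%nat). pose proof (Ca 1%nat). pose proof (Ca 2%nat).
  pose proof (Cb 0%nat). pose proof (Cb 1%nat).
  assert (continuity (fun x : R => (1 + x ^ 2) ^ 2)) by solve_continuity.
  match goal with |- continuity ?f => let g := eval cbv delta [darboux'] beta in f in
    change (continuity g) end. solve_continuity.
Qed.

Lemma darboux_derive (k q : R) (a b : nat -> R -> R) (x : R) :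
  smooth_unit a -> smooth_unit b -> 0 < x < 1 ->
  is_derive (darboux k q a b) x (darboux' k q a b x).
Proof.
  intros [_ Da] [_ Db] Hx.
  pose proof (Da 0%nat x Hx) as Da0. pose proof (Da 1%nat x Hx) as Da1.
  pose proof (Db 0%nat x Hx) as Db0.
  unfold darboux, darboux'. auto_derive.
  - repeat split; try (eexists; eassumption); nra.
  - rewrite (Derive_eta (a 0%nat) _ _ Da0), (Derive_eta (a 1%nat) _ _ Da1),
      (Derive_eta (b 0%nat) _ _ Db0).
    field. nra.
Qed.

(* Real part of [((kappa x - W) w + kappa^2 v) / (1-x^2)]: the value of [w'] forced
   by the mode equation, free of second derivatives of [u]. *)
Definition darboux_slope (k q : R) (a b : nat -> R -> R) (x : R) : R :=
  ((k * x - 2 * (1 - x ^ 2) / (x * (1 + x ^ 2))) * darboux k q a b x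
   - q * x * darboux k (- q) b a x
   + (k ^ 2 - q ^ 2) * (x * a 0%nat x) - 2 * k * q * (x * b 0%nat x))
  / (1 - x ^ 2).

(** With [L = (1-x^2) d/dx - kappa x], the mode equation for [v = x u] factors as
    [(L + W)(L - W) v = kappa^2 v], by the Riccati equation [(1-x^2) W' + W^2 = (1-x^2) V/x^2].
    Since [w = (L - W) v], this is [(L + W) w = kappa^2 v]. *)
Lemma darboux'_factor (k q : R) (a b : nat -> R -> R) (x : R) :
  mode_real k q a b -> 0 < x < 1 ->
  darboux' k q a b x = darboux_slope k q a b x.
Proof.
  intros E Hx. specialize (E x Hx). unfold V in E.
  assert (Ha2 : a 2%nat x = (- 2 * ((1 - x ^ 2) / x) * a 1%nat x
    + 2 * x * ((k + 1) * a 1%nat x - q * b 1%nat x)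
    + 2 * (1 - 6 * x ^ 2 + x ^ 4) / (1 + x ^ 2) ^ 2 / x ^ 2 * a 0%nat x
    + (((k + 1) * (k + 2) - q ^ 2) * a 0%nat x - q * (2 * k + 3) * b 0%nat x))
    / (1 - x ^ 2)).
  { apply Rmult_eq_reg_l with (1 - x ^ 2); [| nra].
    apply Rminus_diag_uniq. rewrite <- (Ropp_involutive (_ - _)).
    apply Ropp_eq_0_compat. rewrite <- E. field. repeat split; nra. }
  unfold darboux', darboux_slope, darboux. rewrite Ha2. field. repeat split; nra.
Qed.

(** Applying [L - W] to [(L + W) w = kappa^2 v] gives [(L - W)(L + W) w = kappa^2 w]. Swapping the
    factors flips the sign of [W'], and [W^2 - (1-x^2) W' = (1-x^2) U] with [U] the partner
    potential. *)
Lemma darboux_partner (k q : R) (a b : nat -> R -> R) :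
  smooth_unit a -> smooth_unit b -> mode_real k q a b -> mode_real k (- q) b a ->
  exists z : R -> R,
    (forall x, 0 < x < 1 -> is_derive (darboux' k q a b) x (z x)) /\
    partner_real k q (darboux k q a b) (darboux k (- q) b a)
      (darboux' k q a b) (darboux' k (- q) b a) z.
Proof.
  intros Sa Sb Ea Eb.
  exists (fun x => Derive (darboux_slope k q a b) x).
  assert (HD : forall x, 0 < x < 1 ->
    is_derive (darboux_slope k q a b) x
      (((k + 2 * (1 + 4 * x ^ 2 - x ^ 4) / (x * (1 + x ^ 2)) ^ 2) * darboux k q a b x
        + (k * x - 2 * (1 - x ^ 2) / (x * (1 + x ^ 2))) * darboux' k q a b x
        - q * darboux k (- q) b a x - q * x * darboux' k (- q) b a x
        + (k ^ 2 - q ^ 2) * (a 0%nat x + x * a 1%nat x)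
        - 2 * k * q * (b 0%nat x + x * b 1%nat x)
        + 2 * x * darboux_slope k q a b x) / (1 - x ^ 2))).
  { intros x Hx.
    pose proof (darboux_derive k q a b x Sa Sb Hx) as Dw1.
    pose proof (darboux_derive k (- q) b a x Sb Sa Hx) as Dw2.
    pose proof (proj2 Sa 0%nat x Hx) as Da. pose proof (proj2 Sb 0%nat x Hx) as Db.
    unfold darboux_slope. auto_derive.
    - repeat split; try (eexists; eassumption); nra.
    - rewrite (Derive_eta (a 0%nat) _ _ Da), (Derive_eta (b 0%nat) _ _ Db),
        (Derive_eta (darboux k q a b) _ _ Dw1),
        (Derive_eta (darboux k (- q) b a) _ _ Dw2).
      field. repeat split; nra. }
  split.
  - intros x Hx.
    apply is_derive_ext_loc with (f := darboux_slope k q a b).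
    + apply filter_imp with (2 := locally_Ioo 0 1 x Hx).
      intros y Hy. symmetry. apply darboux'_factor; assumption.
    + apply Derive_correct. eexists. apply HD, Hx.
  - intros x Hx. rewrite (is_derive_unique _ _ _ (HD x Hx)).
    rewrite (darboux'_factor k q a b x Ea Hx), (darboux'_factor k (- q) b a x Eb Hx).
    unfold darboux_slope, darboux, partner_potential. field. repeat split; nra.
Qed.

(** * Behaviour at the origin, vanishing of the transform, and its kernel *)

(** Multiplied by [x^2], the equation extends continuously to [x = 0], where only the potential term
    survives and [V 0 = 2]. *)
Lemma mode_real_origin (k q : R) (a b : nat -> R -> R) :
  smooth_unit a -> smooth_unit b -> mode_real k q a b -> a 0%nat 0 = 0.
Proof.
  intros [Ca _] [Cb _] E.
  set (f := fun x =>
    - (x ^ 2 * (1 - x ^ 2) * a 2%nat x) - 2 * (x * (1 - x ^ 2)) * a 1%nat x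
    + 2 * (x * x ^ 2) * ((k + 1) * a 1%nat x - q * b 1%nat x)
    + 2 * (1 - 6 * x ^ 2 + (x ^ 2) ^ 2) / (1 + x ^ 2) ^ 2 * a 0%nat x
    + x ^ 2 * (((k + 1) * (k + 2) - q ^ 2) * a 0%nat x
               - q * (2 * k + 3) * b 0%nat x)).
  assert (Cf : continuity f).
  { pose proof (Ca 0%nat). pose proof (Ca 1%nat). pose proof (Ca 2%nat).
    pose proof (Cb 0%nat). pose proof (Cb 1%nat).
    unfold f. solve_continuity. }
  assert (Hf : forall x, 0 < x < 1 -> f x = 0).
  { intros x Hx. replace 0 with (x ^ 2 * 0) by ring. rewrite <- (E x Hx) at 1.
    unfold f, V. field. split; nra. }
  pose proof (continuity_zero_closure f 0 1 Cf Rlt_0_1 Hf 0 ltac:(lra)) as H0.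
  unfold f in H0. field_simplify in H0. lra.
Qed.

Lemma darboux_trivial (k q : R) (a b : nat -> R -> R) :
  - 1 / 2 <= k -> smooth_unit a -> smooth_unit b ->
  mode_real k q a b -> mode_real k (- q) b a ->
  forall x, 0 < x < 1 -> darboux k q a b x = 0 /\ darboux k (- q) b a x = 0.
Proof.
  intros Hk Sa Sb Ea Eb.
  destruct (darboux_partner k q a b) as [z1 [D1 P1]]; auto.
  destruct (darboux_partner k (- q) b a) as [z2 [D2 P2]];
    rewrite ?Ropp_involutive in *; auto.
  apply (partner_trivial k q _ _ (darboux' k q a b) (darboux' k (- q) b a) z1 z2);
    auto using darboux_continuity, darboux'_continuity, darboux_derive.
  - unfold darboux. rewrite (mode_real_origin k q a b), (mode_real_origin k (- q) b a);
      auto. ring.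
  - unfold darboux. rewrite (mode_real_origin k q a b), (mode_real_origin k (- q) b a);
      auto. ring.
Qed.

(** At [kappa = 0], [w = 0] is a first-order linear equation solved by [x / (1 + x^2)], so the
    quotient [r] by this solution has zero derivative on [(0,1)]. *)
Lemma darboux_kernel (a b : nat -> R -> R) :
  smooth_unit a -> (forall x, 0 < x < 1 -> darboux 0 0 a b x = 0) ->
  a 0%nat 0 = 0 ->
  exists c, forall x, 0 <= x <= 1 -> a 0%nat x = c * x / (1 + x ^ 2).
Proof.
  intros Sa Hw H0.
  set (r := fun x => a 0%nat x * (1 + x ^ 2) / x).
  assert (Dr : forall x, 0 < x < 1 -> is_derive r x 0).
  { intros x Hx. pose proof (proj2 Sa 0%nat x Hx) as Da.
    specialize (Hw x Hx). unfold darboux in Hw.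
    assert (Ha1 : a 1%nat x = (1 - x ^ 2) / (x * (1 + x ^ 2)) * a 0%nat x).
    { apply Rmult_eq_reg_l with (x * (1 - x ^ 2)); [| nra].
      apply Rminus_diag_uniq. rewrite <- Hw. field. split; nra. }
    unfold r. auto_derive.
    - repeat split; try (eexists; eassumption); nra.
    - rewrite (Derive_eta (a 0%nat) _ _ Da), Ha1. field. split; nra. }
  exists (r (1 / 2)).
  assert (Hr : forall x, 0 < x < 1 -> r x = r (1 / 2)).
  { intros x Hx.
    destruct (MVT_gen r x (1 / 2) (fun _ => 0)) as [c [_ Hc]].
    - intros y Hy. apply Dr. revert Hy. unfold Rmin, Rmax.
      destruct Rle_dec; lra.
    - intros y Hy. apply continuity_pt_filterlim.
      apply (ex_derive_continuous (K := R_AbsRing) (V := R_NormedModule) r).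
      exists 0. apply Dr. revert Hy. unfold Rmin, Rmax. destruct Rle_dec; lra.
    - lra. }
  (* The quotient [r] divides by [x], so the endpoints are reached by continuity of the difference
     instead. *)
  intros x Hx. apply Rminus_diag_uniq. revert x Hx.
  apply continuity_zero_closure; [| lra |].
  - pose proof (proj1 Sa 0%nat). solve_continuity.
  - intros x Hx. rewrite <- (Hr x Hx). unfold r. field. split; nra.
Qed.

(** * Exclusion of nonzero [kappa] and identification of [u] *)

Theorem proposition3p2 (lambda : C) (u : R -> C)
  (hlambda : 1 / 2 <= Re lambda)
  (hsmooth : smooth_on_closed 0 1 u)
  (hnontrivial : exists rho, 0 <= rho <= 1 /\ u rho <> RtoC 0)
  (hsol : solves_mode_equation lambda u) :
  lambda = RtoC 1 /\
  exists c : C, c <> RtoC 0 /\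
    forall rho, 0 <= rho <= 1 ->
      u rho = (c * RtoC rho / RtoC (1 + rho ^ 2))%C.
Proof.
  destruct (smooth_on_closed_parts u hsmooth) as [a [b [Sa [Sb Hu]]]].
  destruct (mode_equation_parts lambda u a b Sa Sb Hu hsol) as [Ea Eb].
  destruct lambda as [p q]. simpl in hlambda, Ea, Eb.
  set (k := p - 1) in *.
  assert (Hk : - 1 / 2 <= k) by (unfold k; lra).
  pose proof (darboux_trivial k q a b Hk Sa Sb Ea Eb) as Hw.
  destruct hnontrivial as [rho [Hrho Hnz]].
  (* Real and imaginary parts of [kappa^2 u = 0], which is what [darboux_slope] leaves once [w] and
     [w'] vanish. *)
  assert (Hkap : forall x, 0 < x < 1 ->
    (k ^ 2 - q ^ 2) * a 0%nat x - 2 * k * q * b 0%nat x = 0 /\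
    (k ^ 2 - q ^ 2) * b 0%nat x + 2 * k * q * a 0%nat x = 0).
  { intros x Hx. destruct (Hw x Hx) as [W1 W2].
    assert (S1 : darboux_slope k q a b x = 0).
    { rewrite <- darboux'_factor by assumption.
      apply (is_derive_det_Ioo (darboux k q a b) (fun _ => 0) x); auto.
      - intros y Hy. apply (Hw y Hy).
      - apply darboux_derive; assumption.
      - apply (is_derive_const (K := R_AbsRing) (V := R_NormedModule)). }
    assert (S2 : darboux_slope k (- q) b a x = 0).
    { rewrite <- darboux'_factor by assumption.
      apply (is_derive_det_Ioo (darboux k (- q) b a) (fun _ => 0) x); auto.
      - intros y Hy. apply (Hw y Hy).
      - apply darboux_derive; assumption.
      - apply (is_derive_const (K := R_AbsRing) (V := R_NormedModule)). }
    unfold darboux_slope in S1, S2. rewrite Ropp_involutive, W1, W2 in *.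
    split; apply Rmult_eq_reg_l with (x / (1 - x ^ 2));
      try (apply Rgt_not_eq, Rdiv_lt_0_compat; nra);
      rewrite Rmult_0_r; [rewrite <- S1 | rewrite <- S2]; field; split; nra. }
  assert (Hkq : k = 0 /\ q = 0).
  { destruct (Req_dec (k ^ 2 + q ^ 2) 0) as [Hz | Hnzk]; [split; nra | exfalso].
    assert (Hab : forall x, 0 < x < 1 -> a 0%nat x = 0 /\ b 0%nat x = 0).
    { intros x Hx. destruct (Hkap x Hx) as [K1 K2].
      (* This is [|kappa|^4 |u|^2 = |kappa^2 u|^2]. *)
      assert (Hs : (k ^ 2 + q ^ 2) ^ 2 * (a 0%nat x ^ 2 + b 0%nat x ^ 2) = 0).
      { transitivity
          (((k ^ 2 - q ^ 2) * a 0%nat x - 2 * k * q * b 0%nat x) ^ 2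
           + ((k ^ 2 - q ^ 2) * b 0%nat x + 2 * k * q * a 0%nat x) ^ 2);
          [ring | rewrite K1, K2; ring]. }
      apply Rmult_integral in Hs. destruct Hs as [Hs | Hs]; [| split; nra].
      exfalso. apply (pow_nonzero _ 2 Hnzk Hs). }
    apply Hnz. rewrite (Hu rho Hrho). unfold RtoC. f_equal.
    - apply (continuity_zero_closure (a 0%nat) 0 1 (proj1 Sa 0%nat) Rlt_0_1); auto.
      intros x Hx. apply Hab, Hx.
    - apply (continuity_zero_closure (b 0%nat) 0 1 (proj1 Sb 0%nat) Rlt_0_1); auto.
      intros x Hx. apply Hab, Hx. }
  destruct Hkq as [Hk0 Hq0].
  split.
  { unfold RtoC. f_equal; [unfold k in Hk0; lra | exact Hq0]. }
  rewrite Hk0, Hq0, Ropp_0 in *.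
  destruct (darboux_kernel a b) as [c1 Hc1]; auto.
  { intros x Hx. apply (Hw x Hx). }
  { apply (mode_real_origin 0 0 a b); assumption. }
  destruct (darboux_kernel b a) as [c2 Hc2]; auto.
  { intros x Hx. apply (Hw x Hx). }
  { apply (mode_real_origin 0 0 b a); assumption. }
  assert (Hform : forall x, 0 <= x <= 1 ->
    u x = ((c1, c2) * RtoC x / RtoC (1 + x ^ 2))%C).
  { intros x Hx. rewrite (Hu x Hx), (Hc1 x Hx), (Hc2 x Hx).
    unfold Cdiv. rewrite <- RtoC_inv by nra.
    unfold Cmult, RtoC. simpl. f_equal; field; nra. }
  exists (c1, c2). split; [| exact Hform].
  intros Hc. apply Hnz. rewrite (Hform rho Hrho), Hc. unfold Cdiv. ring.
Qed.
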